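(* Let $A=[a_1,\dots,a_n]\in\mathbb{R}^{m\times n}$, a positive integer $s\le n$, $q\in[1,\infty]$, $\widehat\lambda>0$ and $0<\kappa<\frac12$ be such that $$\|x\|_{s,q}\le\widehat\lambda s^{1/q}\|Ax\|_2+\kappa s^{1/q-1}\|x\|_1\qquad\forall x\in\mathbb{R}^n,$$ and let $\beta=\max_i\|a_i\|_2$. Let $\sigma>0$, $\epsilon\in(0,1)$ be given, let there be no nuisance ($\mathcal{U}=\{0\}$), and set $\varrho:=\sigma\beta\sqrt{2\ln(n/\epsilon)}$. (i) Consider the Dantzig Selector recovery $\widehat{x}_{\rm DS}(y)\in\mathrm{Argmin}_v\{\|v\|_1:\|A^T(Av-y)\|_\infty\le\rho\}$, where $\rho\ge\varrho$. Then for all $1\le p\le q$ and $\upsilon\ge0$ $$\mathrm{Risk}_p(\widehat{x}_{\rm DS}(\cdot)\,|\,\epsilon,\sigma,s,\upsilon)\le\frac{2(3s)^{1/p}}{1-2\kappa}\left[\frac{2s\widehat\lambda^2(\rho+\varrho)}{1-2\kappa}+s^{-1}\upsilon\right].$$ (ii) Consider the Lasso recovery $\widehat{x}_{\rm lasso}(y)\in\mathrm{Argmin}_v\{\|v\|_1+\varkappa\|Av-y\|_2^2\}$, where $\varkappa>0$ satisfies $2\kappa+2\varrho\varkappa<1$. Then for all $1\le p\le q$ and $\upsilon\ge0$ $$\mathrm{Risk}_p(\widehat{x}_{\rm lasso}(\cdot)\,|\,\epsilon,\sigma,s,\upsilon)\le\frac{4s^{1/p}}{1-2\kappa-2\varrho\varkappa}\left[\frac{2s\widehat\lambda^2}{\varkappa}+s^{-1}\upsilon\right].$$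 In particular, with $\varkappa=\frac{1-2\kappa}{4\varrho}$, one has for all $1\le p\le q$ and $\upsilon\ge0$ $$\mathrm{Risk}_p(\widehat{x}_{\rm lasso}(\cdot)\,|\,\epsilon,\sigma,s,\upsilon)\le\frac{8s^{1/p}}{1-2\kappa}\left[\frac{8s\varrho\widehat\lambda^2}{1-2\kappa}+s^{-1}\upsilon\right].$$
   Context: Observation model: $y=Ax+\sigma\xi\in\mathbb{R}^m$ with $\xi\sim N(0,I_m)$ and unknown $x\in\mathbb{R}^n$. For $x\in\mathbb{R}^n$, $x^s$ is obtained from $x$ by zeroing all but the $s$ largest in magnitude entries (ties resolved in favour of smaller indices), and $\|x\|_{s,q}=\|x^s\|_q$. Convention: $1/\infty=0$. Recoveries are taken to be Borel functions of $y$. $X(s,\upsilon)=\{x\in\mathbb{R}^n:\|x-x^s\|_1\le\upsilon\}$, and (with $\mathcal{U}=\{0\}$) $$\mathrm{Risk}_p(\widehat{x}(\cdot)|\epsilon,\sigma,s,\upsilon)=\inf\{\delta:\mathrm{Prob}\{\xi:\exists x\in X(s,\upsilon):\|\widehat{x}(Ax+\sigma\xi)-x\|_p>\delta\}\le\epsilon\};$$ equivalently, $\mathrm{Risk}_p\le\delta$ iff there is a set $\Xi$ with $\mathrm{Prob}\{\xi\in\Xi\}\ge1-\epsilon$ such that $\|\widehat{x}(Ax+\sigma\xi)-x\|_p\le\delta$ for all $\xi\in\Xi$, $x\in X(s,\upsilon)$. *)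

(* Defs.v *)
From HB Require Import structures.
From mathcomp Require Import all_boot all_order all_algebra.
From mathcomp Require Import all_classical all_reals all_analysis.

Set Implicit Arguments.
Unset Strict Implicit.
Unset Printing Implicit Defensive.

Import Order.TTheory GRing.Theory Num.Theory.
Import numFieldNormedType.Exports.

Local Open Scope classical_set_scope.
Local Open Scope ring_scope.

Section vectors.
Context {R : realType}.

(* Only meant for p in [1, +oo]; the second branch is the case p = +oo. *)
Definition lnorm n (p : \bar R) (x : 'cV[R]_n) : R :=
  if p is r%:E then (\sum_(i < n) `|x i 0| `^ r) `^ r^-1
  else \big[Num.max/0]_(i < n) `|x i 0|.

(* Index [j] comes before [i] when entries are listed by decreasing magnitude,
   ties being resolved in favour of smaller indices. *)
Definition precedes n (x : 'cV[R]_n) (j i : 'I_n) : bool :=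
  (`|x i 0| < `|x j 0|) || ((`|x j 0| == `|x i 0|) && (j < i)%N).

(* The vector x^s: entry i is kept iff fewer than s entries come before it. *)
Definition truncate n (s : nat) (x : 'cV[R]_n) : 'cV[R]_n :=
  \col_(i < n) if (#|[set j | precedes x j i]%SET| < s)%N then x i 0 else 0.

Definition trunc_norm n (s : nat) (q : \bar R) (x : 'cV[R]_n) : R :=
  lnorm q (truncate s x).

Definition nearly_sparse n (s : nat) (upsilon : R) : set 'cV[R]_n :=
  [set x | lnorm 1%E (x - truncate s x) <= upsilon].

Definition max_col_norm m n (A : 'M[R]_(m, n)) : R :=
  \big[Num.max/0]_(i < n) lnorm 2%:E (col i A).

Definition Argmin n (D : set 'cV[R]_n) (f : 'cV[R]_n -> R) : set 'cV[R]_n :=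
  [set v | D v /\ forall w, D w -> f v <= f w].

Definition borel_fun m n (f : 'cV[R]_m -> 'cV[R]_n) : Prop :=
  forall U : set 'cV[R]_n, open U ->
    <<s [set V : set 'cV[R]_m | open V] >> (f @^-1` U).

Definition dantzig_selector m n (A : 'M[R]_(m, n)) (rho : R)
    (xhat : 'cV[R]_m -> 'cV[R]_n) : Prop :=
  forall y, Argmin [set v | lnorm +oo%E (A^T *m (A *m v - y)) <= rho]
                   (lnorm 1%E) (xhat y).

Definition lasso m n (A : 'M[R]_(m, n)) (varkappa : R)
    (xhat : 'cV[R]_m -> 'cV[R]_n) : Prop :=
  forall y, Argmin setT
    (fun v => lnorm 1%E v + varkappa * lnorm 2%:E (A *m v - y) ^+ 2) (xhat y).

End vectors.

Section gaussian_observation.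
Context {R : realType} {d : measure_display} {T : measurableType d}.
Variable P : probability T R.

(* xi ~ N(0, I_m): the joint law of the coordinates is the m-fold product of
   N(0, 1), expressed on measurable boxes (which determine it). *)
Definition standard_gaussian m (xi : 'I_m -> {RV P >-> R}) : Prop :=
  forall B : 'I_m -> set R, (forall i, measurable (B i)) ->
    P (\bigcap_i (xi i @^-1` B i)) = (\prod_(i < m) normal_prob 0 1 (B i))%E.

(* The event below is analytic when [xhat] is Borel: it need not be in the
   sigma-algebra, but it is measurable for the completion of P, and its
   probability is its outer measure. In particular, it is at most eps iff the
   complement contains a measurable set of probability at least 1 - eps. *)
Definition risk m n (A : 'M[R]_(m, n)) (xi : 'I_m -> {RV P >-> R})
    (xhat : 'cV[R]_m -> 'cV[R]_n) (p : \bar R) (eps sigma : R) (s : nat)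
    (upsilon : R) : \bar R :=
  ereal_inf [set delta%:E | delta in [set delta : R |
    (mu_ext P [set w | exists2 x, nearly_sparse s upsilon x &
       (delta < lnorm p (xhat (A *m x + sigma *: \col_i xi i w) - x))%R]
     <= eps%:E)%E]].

End gaussian_observation.

(* Main.v *)
Require Import Defs.
From HB Require Import structures.
From mathcomp Require Import all_boot all_order all_algebra.
From mathcomp Require Import all_classical all_reals all_analysis.
From mathcomp Require Import measurable_realfun ring lra.

Set Implicit Arguments.
Unset Strict Implicit.
Unset Printing Implicit Defensive.

Import Order.TTheory GRing.Theory Num.Theory.
Import numFieldNormedType.Exports.

(** The proof separates a probabilistic and a deterministic part, which meet in
    a single event.

    Probability. Write e for the noise sigma xi.  Each correlation of e with a
    column a_i is a linear form in independent standard normals, hence a centred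
    normal variable of standard deviation at most sigma beta
    ([linear_form_law]).  The two-sided tail satisfies
    P(|g| > t) <= exp(-t^2/2) with constant one, which is what makes the
    threshold varrho come out without an additional factor 2 inside the
    logarithm ([normal_prob_two_sided_tail]).  A union bound over the n columns
    shows that all correlations are at most varrho outside an event of
    probability at most eps ([linear_forms_union_bound]).  That event does not
    depend on the signal, so the bad set in the definition of the risk, although
    not measurable in general, is covered by it
    ([risk_le_bounded_correlation]).

    Determinism. Let z be the error xhat - x, N its l1 norm and u the Euclidean
    norm of A z.  The following holds whenever all correlations are at most
    varrho.  Comparing l1 norms of xhat and x shows that z is concentrated on
    its s leading entries up to 2 upsilon ([l1_cone]).  The norm condition on A
    bounds the l1 norm of these leading entries by lambda s u + kappa N, so that
    (1 - 2 kappa) N <= 2 lambda s u + 2 upsilon plus the gain in l1 norm of xhat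
    over x ([l1_error_bound]).  Optimality of xhat supplies the missing
    relation: for the Dantzig selector u^2 <= (rho + varrho) N, for the Lasso
    varkappa u^2 enters the previous inequality at the cost of
    2 varrho varkappa N.  Solving the resulting quadratic inequalities
    ([dantzig_estimate], [lasso_estimate]) gives a number W such that
    N <= 2 s W and the q-norm of the truncation of z is at most s^(1/q) W.
    These two facts control all p-norms, p <= q ([lnorm_le_of_trunc_norm]): by
    power means the leading entries contribute at most s W^p to the sum of p-th
    powers, while the other entries are at most W each and at most 2 s W in
    total, hence contribute at most 2 s W^p. *)

Local Open Scope classical_set_scope.
Local Open Scope ring_scope.

(** * Affine substitutions and densities *)

Section affine.
Variable R : realType.
Local Notation mu := (@lebesgue_measure R).

(** Both sides are measures in B, so uniqueness of the Lebesgue measure reduces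
    the identity to intervals; for a < 0 the preimage of a left-open interval is
    right-open, which has the same length. *)
Lemma lebesgue_measure_affine (a b : R) (B : set R) : a != 0 -> measurable B ->
  mu B = (`|a|%:E * mu ((fun x : R => a * x + b)%R @^-1` B))%E.
Proof.
move=> a0 mB.
have mh : measurable_fun [set: measurableTypeR R]
    ((fun x => a * x + b) : measurableTypeR R -> measurableTypeR R).
  by apply: measurable_funD => //; apply: measurable_funM.
have a1 : 0 <= `|a| by [].
pose h : measurableTypeR R -> measurableTypeR R := fun x => a * x + b.
pose nu := mscale (NngNum a1) (pushforward mu h : {measure set _ -> \bar R}).
suff H : forall X, ocitv X -> mu X = nu mh X.
  exact: (@lebesgue_measure_unique _ (nu mh) H).
move=> _ [[u v] _ <-]; rewrite /nu/= /mscale/= /pushforward.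
case: (ltgtP a 0) a0 => // [a_lt0|a_gt0] _.
  have -> : (fun x : R => a * x + b) @^-1` `]u, v]%classic
     = `[(v - b) / a, (u - b) / a[%classic.
    apply/seteqP; split=> x /=; rewrite !in_itv/=;
      rewrite ler_ndivrMr// ltr_ndivlMr// => /andP[? ?]; apply/andP; split; lra.
  rewrite !lebesgue_measure_itv/= !lte_fin ltr_nM2r ?invr_lt0// ltrD2r.
  case: ifPn => _; rewrite ?mule0//= -EFinB -EFinM ltr0_norm//.
  by congr EFin; field; rewrite lt_eqF.
have -> : (fun x : R => a * x + b) @^-1` `]u, v]%classic
   = `](u - b) / a, (v - b) / a]%classic.
  apply/seteqP; split=> x /=; rewrite !in_itv/=;
    rewrite ler_pdivlMr// ltr_pdivrMr// => /andP[? ?]; apply/andP; split; lra.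
rewrite !lebesgue_measure_itv/= !lte_fin ltr_pM2r ?invr_gt0// ltrD2r.
case: ifPn => _; rewrite ?mule0//= -EFinB -EFinM gtr0_norm//.
by congr EFin; field; rewrite gt_eqF.
Qed.

Lemma ge0_integral_affine (a b : R) (f : R -> \bar R) : a != 0 ->
  measurable_fun [set: R] f -> (forall x, 0 <= f x)%E ->
  (\int[mu]_x f x = `|a|%:E * \int[mu]_x f (a * x + b)%R)%E.
Proof.
move=> a0 mf f0.
have mh : measurable_fun [set: measurableTypeR R]
    ((fun x => a * x + b) : measurableTypeR R -> measurableTypeR R).
  by apply: measurable_funD => //; apply: measurable_funM.
have a1 : 0 <= `|a| by [].
pose h : measurableTypeR R -> measurableTypeR R := fun x => a * x + b.
pose nu := mscale (NngNum a1) (pushforward mu h : {measure set _ -> \bar R}).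
transitivity (\int[nu mh]_x f x)%E.
  by apply: eq_measure_integral => B mB _; exact: lebesgue_measure_affine.
rewrite ge0_integral_mscale//=; congr (_ * _)%E.
by rewrite ge0_integral_pushforward//.
Qed.

(** The density is a Radon-Nikodym derivative almost everywhere.  The bound
    f <= 1 serves integrability only; it is what probabilities of sections
    satisfy. *)
Lemma ge0_integral_normal_prob (f : R -> \bar R) (s : R) :
  measurable_fun [set: R] f -> (forall x, 0 <= f x)%E -> (forall x, f x <= 1)%E ->
  (\int[normal_prob 0 s]_x f x = \int[mu]_x (f x * (normal_pdf 0 s x)%:E))%E.
Proof.
move=> mf f0 f1.
have dom := normal_prob_dominates 0 s.
rewrite -(Radon_Nikodym_change_of_variables dom)//=; last first.
  apply/integrableP; split => //.
  apply: (@le_lt_trans _ _ (\int[normal_prob 0 s]_x cst 1 x)%E).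
    apply: ge0_le_integral => //=; first exact: measurableT_comp.
    by move=> x _; rewrite gee0_abs.
  by rewrite integral_cst//= mul1e probability_setT ltry.
apply: ae_eq_integral => //.
- exact: emeasurable_funM.
- apply: emeasurable_funM => //.
  by apply/measurable_EFinP; exact: measurable_normal_pdf.
- apply: ae_eqe_mul2l => /=.
  rewrite Radon_NikodymE.
  case: cid => /= h [h1 h2 h3].
  apply: integral_ae_eq => //=.
  + by apply/measurable_EFinP; exact: measurable_normal_pdf.
  + by move=> E _ mE; rewrite -h3.
Qed.
End affine.

(** * Rotations of the standard Gaussian plane *)

Section rotation.
Variable R : realType.
Local Notation mu := (@lebesgue_measure R).
Local Notation phi := (normal_pdf (0 : R) 1).
Local Notation gamma := (@normal_prob R 0 1).

Lemma normal_pdf01E (x : R) : phi x = normal_peak 1 * expR (- x ^+ 2 / 2).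
Proof.
rewrite normal_pdfE ?oner_neq0// /normal_fun subr0 expr1n.
by rewrite [X in _ / X]mulr2n.
Qed.

(** The Gaussian density of the plane in the coordinates (x, u), u = a x + s y,
    completed to a square in x: this is the disintegration along the value u. *)
Lemma normal_pdf_rotation (a s r u x : R) : s != 0 -> r != 0 ->
  r ^+ 2 = a ^+ 2 + s ^+ 2 ->
  phi x * phi ((u - a * x) / s) = phi (u / r) * phi (r / s * x - a * u / (s * r)).
Proof.
move=> s0 r0 rE; rewrite !normal_pdf01E mulrACA [RHS]mulrACA -!expRD.
congr (_ * expR _); apply/eqP; rewrite -!mulrDl; apply/eqP; congr (_ / _).
apply: (@mulIf _ ((s * r) ^+ 2)); first by rewrite sqrf_eq0 mulf_neq0.
transitivity (- (x ^+ 2 * s ^+ 2 + (u - a * x) ^+ 2) * r ^+ 2).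
  by field.
transitivity (- (u ^+ 2 * s ^+ 2 + (r ^+ 2 * x - a * u) ^+ 2)).
  by rewrite rE; ring.
by field; apply/andP.
Qed.

Lemma measurable_affine (a b : R) : measurable_fun setT (fun x : R => a * x + b).
Proof. by apply: measurable_funD => //; apply: measurable_funM. Qed.

(** The law of a g + b, g standard normal, through its density; the factor |a| is
    kept on the left so that no division occurs among extended reals. *)
Lemma normal_prob_linear_preimage (a b : R) (B : set R) : a != 0 -> measurable B ->
  (`|a|%:E * gamma ((fun y => a * y + b)%R @^-1` B))%E =
  (\int[mu]_u (\1_B u * phi ((u - b) / a))%:E)%E.
Proof.
move=> a0 mB.
rewrite [RHS](@ge0_integral_affine _ a b)//; last 2 first.
- apply/measurable_EFinP; apply: measurable_funM => //.
  apply: measurableT_comp; first exact: measurable_normal_pdf.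
  by apply: measurable_funM => //; apply: measurable_funB.
- by move=> x; rewrite lee_fin mulr_ge0// normal_pdf_ge0.
congr (_ * _)%E; rewrite /normal_prob integral_mkcond; apply: eq_integral => y _.
rewrite patchE /= (_ : (a * y + b - b) / a = y); last by field.
rewrite indicE; case: ifPn => /= yB; last first.
  by rewrite memNset ?mul0r//; move: yB; rewrite notin_setE.
by rewrite mem_set ?mul1r//; move: yB; rewrite inE.
Qed.

(** If g and g' are independent standard normals, a g + s g' has the law of r g.
    By Tonelli the left side is an integral over (x, u) with u = a x + s y;
    after the square has been completed in x, the integral over x is a
    normalization constant and what remains is the density of r g at u. *)
Lemma standard_gaussian_rotation (a s r : R) (B : set R) : s != 0 ->
  r ^+ 2 = a ^+ 2 + s ^+ 2 -> measurable B ->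
  (gamma \x gamma)%E [set z | B (a * z.1 + s * z.2)] =
  gamma [set x | B (r * x)].
Proof.
move=> s0 rE mB.
have r0 : r != 0.
  by rewrite -sqrf_eq0 rE gt_eqF// ltr_wpDl ?sqr_ge0// exprn_even_gt0.
have mD : measurable [set z : R * R | B (a * z.1 + s * z.2)].
  rewrite -[X in measurable X]setTI.
  have : measurable_fun [set: R * R] (fun z : R * R => a * z.1 + s * z.2).
    by apply: measurable_funD => //; apply: measurable_funM.
  by move=> /(_ measurableT B mB).
have rs0 : r / s != 0 by rewrite mulf_neq0 ?invr_neq0.
(* G is the density of (x, u) up to the factor 1/|s|, restricted to u in B. *)
pose G (x u : R) : R := \1_B u * phi x * phi ((u - a * x) / s).
have G0 x u : 0 <= G x u by rewrite !mulr_ge0// normal_pdf_ge0.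
have mG : measurable_fun [set: R * R] (fun z => (G z.1 z.2)%:E).
  apply/measurable_EFinP; apply: measurable_funM.
    apply: measurable_funM; first exact: measurableT_comp.
    by apply: measurableT_comp => //; exact: measurable_normal_pdf.
  apply: measurableT_comp; first exact: measurable_normal_pdf.
  by apply: measurable_funM => //; apply: measurable_funB => //; apply: measurable_funM.
have L : (`|s|%:E * (gamma \x gamma) [set z | B (a * z.1 + s * z.2)%R])%E =
   (\int[mu]_x \int[mu]_u (G x u)%:E)%E.
  rewrite /product_measure1 ge0_integral_normal_prob//; last 2 first.
  - exact: measurable_fun_xsection.
  - by move=> x; apply: probability_le1; exact: measurable_xsection.
  rewrite -ge0_integralZl//; last 2 first.
  - apply: emeasurable_funM; first exact: measurable_fun_xsection.
    by apply/measurable_EFinP; exact: measurable_normal_pdf.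
  - by move=> x _; rewrite mule_ge0// lee_fin normal_pdf_ge0.
  apply: eq_integral => x _; rewrite muleA [(_ \o _) x]/=.
  have -> : xsection [set z : R * R | B (a * z.1 + s * z.2)] x =
     (fun y => s * y + a * x)%R @^-1` B.
    by apply/seteqP; split=> y; rewrite /xsection/= inE/= addrC.
  rewrite normal_prob_linear_preimage// muleC -ge0_integralZl//; last 3 first.
  - apply/measurable_EFinP; apply: measurable_funM => //.
    apply: measurableT_comp; first exact: measurable_normal_pdf.
    by apply: measurable_funM => //; apply: measurable_funB.
  - by move=> u _; rewrite lee_fin mulr_ge0// normal_pdf_ge0.
  - by rewrite lee_fin normal_pdf_ge0.
  by apply: eq_integral => u _; rewrite -EFinM /G; congr EFin; ring.
have RH : (`|r / s|%:E * \int[mu]_x \int[mu]_u (G x u)%:E)%E =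
   (`|r|%:E * gamma [set x | B (r * x)%R])%E.
  have -> : [set x | B (r * x)] = (fun y => r * y + 0) @^-1` B.
    by apply/seteqP; split=> y /=; rewrite addr0.
  rewrite normal_prob_linear_preimage//.
  rewrite (@fubini_tonelli _ _ _ _ _ mu mu (fun z => (G z.1 z.2)%:E))//; last first.
    by move=> z; rewrite lee_fin.
  rewrite -ge0_integralZl//; last 2 first.
  - apply: (@measurable_fun_fubini_tonelli_G _ _ _ _ _ mu (fun z => (G z.1 z.2)%:E)) => //.
    by move=> z; rewrite lee_fin.
  - by move=> u _; apply: integral_ge0 => x _; rewrite lee_fin.
  apply: eq_integral => u _; rewrite subr0.
  have -> : (\int[mu]_x (G x u)%:E = (\1_B u * phi (u / r))%:E *
     \int[mu]_x (phi (r / s * x + - (a * u / (s * r))))%:E)%E.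
    rewrite -ge0_integralZl; last 4 first.
    - exact: measurableT.
    - apply/measurable_EFinP; apply: measurableT_comp; first exact: measurable_normal_pdf.
      exact: measurable_affine.
    - by move=> x _; rewrite lee_fin normal_pdf_ge0.
    - by rewrite lee_fin mulr_ge0// normal_pdf_ge0.
    apply: eq_integral => x _; rewrite -EFinM; congr EFin.
    by rewrite /G -mulrA (normal_pdf_rotation _ _ s0 r0 rE) mulrA.
  rewrite muleCA -(@ge0_integral_affine _ _ _ (fun x => (phi x)%:E))//.
  - by rewrite integral_normal_pdf mule1.
  - by apply/measurable_EFinP; exact: measurable_normal_pdf.
  - by move=> x; rewrite lee_fin normal_pdf_ge0.
move: RH; rewrite -L muleA -EFinM -normrM divfK//.
move=> /(congr1 (mule `|r|^-1%:E)).
by rewrite !muleA -EFinM mulVf ?normr_eq0// !mul1e.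
Qed.
End rotation.

(** * The two-sided Gaussian tail *)

Section gaussian_tail.
Variable R : realType.
Local Notation mu := (@lebesgue_measure R).
Local Notation phi := (normal_pdf (0 : R) 1).
Local Notation gamma := (@normal_prob R 0 1).

Lemma measurable_lt_mulr (e t : R) : measurable [set x : R | t < e * x].
Proof.
rewrite -[X in measurable X]setTI.
have : measurable_fun [set: R] (fun x : R => e * x).
  by apply: measurable_funM.
move=> /(_ measurableT `]t, +oo[%classic (measurable_itv _)).
by congr measurable; congr (_ `&` _); apply/seteqP; split=> x /=; rewrite in_itv/= andbT.
Qed.

(** Shifting by t multiplies the density at y > 0 by exp(- t y - t^2/2), which is
    at most exp(-t^2/2).  The sign e treats both tails at once. *)
Lemma normal_prob_half_tail (e t : R) : e ^+ 2 = 1 -> 0 <= t ->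
  (gamma [set x | (t < e * x)%R] <=
   (expR (- t ^+ 2 / 2))%:E * gamma [set x | (0 < e * x)%R])%E.
Proof.
move=> e1 t0; rewrite /normal_prob [leLHS]integral_mkcond [X in (_ <= _ * X)%E]integral_mkcond.
have mpat (u : R) : measurable_fun [set: R]
    ((fun x => (phi x)%:E) \_ [set x | u < e * x]).
  apply/(measurable_restrictT _ _).1; first exact: measurable_lt_mulr.
  by apply: measurable_funTS; apply/measurable_EFinP; exact: measurable_normal_pdf.
have pat0 (u x : R) : (0 <= ((fun x => (phi x)%:E) \_ [set x | (u < e * x)%R]) x)%E.
  by apply: erestrict_ge0 => y _; rewrite lee_fin normal_pdf_ge0.
rewrite (@ge0_integral_affine _ 1 (e * t))//.
rewrite normr1 mul1e -ge0_integralZl//; last exact: mpat.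
apply: ge0_le_integral => //.
- have mh : measurable_fun [set: R] (fun x : R => 1 * x + e * t).
    exact: measurable_affine.
  exact: (measurableT_comp (mpat t) mh).
- by apply: measurable_funeM; exact: mpat.
have memE (u y : R) : (y \in [set x : R | u < e * x]) = (u < e * y).
  by apply/idP/idP; rewrite inE.
move=> x _; rewrite !patchE !memE mul1r mulrDr (mulrA e e t) -expr2 e1 mul1r.
rewrite ltrDr; case: ifPn => // ex; last by rewrite mule0.
rewrite -EFinM lee_fin !normal_pdf01E mulrCA ler_wpM2l ?normal_peak_ge0//.
rewrite -expRD ler_expR.
have : 0 <= t * (e * x) by rewrite mulr_ge0// ltW.
have -> : (x + e * t) ^+ 2 = x ^+ 2 + 2 * (t * (e * x)) + e ^+ 2 * t ^+ 2 by ring.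
by rewrite e1 mul1r; lra.
Qed.

(** The two half tails are bounded by exp(-t^2/2) times the masses of the two open
    half lines, and these masses add up to at most one. *)
Lemma normal_prob_two_sided_tail (t : R) : 0 <= t ->
  (gamma [set x | (t < `|x|)%R] <= (expR (- t ^+ 2 / 2))%:E)%E.
Proof.
move=> t0.
have E (u : R) : 0 <= u ->
    gamma [set x | u < `|x|] = (gamma [set x | (u < 1 * x)%R] + gamma [set x | (u < -1 * x)%R])%E.
  move=> u0; rewrite -measureU; last 3 first.
  - exact: measurable_lt_mulr.
  - exact: measurable_lt_mulr.
  - by apply/seteqP; split=> // x /= []; lra.
  congr gamma; apply/seteqP; split=> x /=; rewrite lter_normr mul1r mulN1r.
    by move=> /orP.
  by move=> ?; apply/orP.
rewrite E//; apply: (@le_trans _ _ ((expR (- t ^+ 2 / 2))%:E *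
    (gamma [set x | (0 < 1 * x)%R] + gamma [set x | (0 < -1 * x)%R])))%E.
  rewrite ge0_muleDr//; apply: leeD; apply: normal_prob_half_tail => //.
    by rewrite expr1n.
  by rewrite sqrrN expr1n.
rewrite -E// -[leRHS]mule1; apply: lee_wpmul2l; first by rewrite lee_fin expR_ge0.
have mset : measurable [set x : R | 0 < `|x|].
  rewrite (_ : [set x | _] = [set x : R | 0 < 1 * x] `|` [set x | 0 < -1 * x]).
    by apply: measurableU; exact: measurable_lt_mulr.
  apply/seteqP; split=> x /=; rewrite lter_normr mul1r mulN1r.
    by move=> /orP.
  by move=> ?; apply/orP.
exact: probability_le1.
Qed.

End gaussian_tail.

(** * Linear forms in independent standard normals *)

Lemma finite_measure_eq_rectangles (d1 d2 : measure_display)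
    (T1 : measurableType d1) (T2 : measurableType d2) (R : realType)
    (m1 m2 : {measure set (T1 * T2) -> \bar R}) :
  (m1 setT < +oo)%E ->
  (forall X Y, measurable X -> measurable Y -> m1 (X `*` Y) = m2 (X `*` Y)) ->
  forall D, measurable D -> m1 D = m2 D.
Proof.
move=> m1oo m12 D mD.
pose C : set (set (T1 * T2)) :=
  [set X `*` Y | X in measurable & Y in measurable].
apply: (measure_unique C (fun=> setT)) => //.
- exact: measurable_prod_measurableType.
- move=> /= _ _ [X1 mX1 [X2 mX2 <-]] [Y1 mY1 [Y2 mY2 <-]].
  rewrite -setXI; exists (X1 `&` Y1); first exact: measurableI.
  by exists (X2 `&` Y2) => //; exact: measurableI.
- by move=> _; exists setT => //; exists setT => //; rewrite setXTT.
- by apply/seteqP; split => // x _; exists 0%N.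
- by move=> _ [X mX [Y mY <-]]; exact: m12.
Qed.

Section linear_forms.
Context {R : realType} {d : measure_display} {T : measurableType d}.
Variable P : probability T R.
Variables (m : nat) (xi : 'I_m -> {RV P >-> R}).
Hypothesis hxi : standard_gaussian xi.
Local Notation gamma := (@normal_prob R 0 1).

Let mxi i : measurable_fun [set: T] (xi i : T -> R). Proof. by []. Qed.

Lemma measurable_linear_form (I : pred 'I_m) (a : 'I_m -> R) :
  measurable_fun [set: T] (fun w => \sum_(j | I j) a j * xi j w).
Proof.
rewrite (_ : (fun w => _) =
    (fun w => \sum_j (if I j then a j * xi j w else 0))); last first.
  by apply/funext => w; rewrite big_mkcond.
by apply: measurable_sum => j; case: (I j) => //; apply: measurable_funM.
Qed.

Lemma measurable_trailing_box (k : nat) (C : 'I_m -> set R) :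
  (forall j, measurable (C j)) ->
  measurable [set w | forall j : 'I_m, (k <= j)%N -> C j (xi j w)].
Proof.
move=> mC.
rewrite (_ : [set w | _] =
    \bigcap_(j in [set j : 'I_m | (k <= j)%N]) (xi j @^-1` C j)).
  apply: fin_bigcap_measurable => // j _.
  by rewrite -[X in measurable X]setTI; exact: mxi.
by apply/seteqP; split=> w /= wC j; exact: wC.
Qed.

Let fine_gamma (B : set R) : measurable B -> (fine (gamma B))%:E = gamma B.
Proof. by move=> mB; rewrite fineK// fin_num_measure. Qed.

(** Joint form of the law of a partial sum, suited to induction: keeping the not
    yet summed coordinates in arbitrary sets records that the partial sum is
    independent of them.  In the step from k to k + 1, boxes determine the joint
    law of the partial sum and the k-th coordinate, so it is the image of a
    product of standard normals, and a rotation computes the law of the new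
    partial sum.  The sign of r is left free since normal laws are symmetric. *)
Lemma partial_linear_form_law (a : 'I_m -> R) (k : nat) : (k <= m)%N ->
  exists2 r : R, r ^+ 2 = \sum_(j < m | (j < k)%N) a j ^+ 2 &
  forall (B : set R) (C : 'I_m -> set R), measurable B ->
    (forall j, measurable (C j)) ->
  P ([set w | B (\sum_(j < m | (j < k)%N) a j * xi j w)] `&`
     [set w | forall j : 'I_m, (k <= j)%N -> C j (xi j w)]) =
  (gamma [set x | B (r * x)%R] * (\prod_(j < m | (k <= j)%N) fine (gamma (C j)))%:E)%E.
Proof.
elim: k => [_|k IH km].
  exists 0; first by rewrite big_pred0// expr0n.
  move=> B C mB mC.
  have -> : [set w | forall j : 'I_m, (0 <= j)%N -> C j (xi j w)] =
      \bigcap_i (xi i @^-1` C i).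
    by apply/seteqP; split=> w /= wC j; [move=> _; exact: wC|move=> _; exact: wC].
  have -> : [set x | B (0 * x)] = [set _ | B 0].
    by apply/seteqP; split=> x /=; rewrite mul0r.
  have -> : [set w | B (\sum_(j < m | (j < 0)%N) a j * xi j w)] = [set _ | B 0].
    by apply/seteqP; split=> x /=; rewrite big_pred0.
  have [B0|B0] := pselect (B 0); last first.
    have E (U : Type) : [set _ : U | B 0] = set0 by apply/seteqP; split.
    by rewrite !E set0I !measure0 mul0e.
  have E (U : Type) : [set _ : U | B 0] = setT by apply/seteqP; split.
  rewrite !E setTI probability_setT mul1e hxi//.
  rewrite (big_morph EFin EFinM erefl).
  by apply: eq_big => // j _; rewrite fine_gamma.
have {IH} [r rE IH] := IH (ltnW km).
pose i := Ordinal km.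
have lti (j : 'I_m) : (j < k.+1)%N = (j == i) || (j < k)%N.
  by rewrite ltnS leq_eqVlt.
have lei (j : 'I_m) : (k <= j)%N = (j == i) || (k.+1 <= j)%N.
  by rewrite leq_eqVlt eq_sym.
have sumi (V : nmodType) (F : 'I_m -> V) :
    \sum_(j < m | (j < k.+1)%N) F j = \sum_(j < m | (j < k)%N) F j + F i.
  rewrite (bigD1 i)//= addrC; congr (_ + _); apply: eq_bigl => j.
  by rewrite lti; case: eqVneq => //= [->|]; rewrite ?ltnn ?andbT ?andbF.
have prodi (F : 'I_m -> R) :
    \prod_(j < m | (k <= j)%N) F j = F i * \prod_(j < m | (k.+1 <= j)%N) F j.
  rewrite (bigD1 i)//=; congr (_ * _); apply: eq_bigl => j.
  by rewrite lei; case: eqVneq => //= [->|]; rewrite ?ltnn ?andbT ?andbF.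
pose S w := \sum_(j < m | (j < k)%N) a j * xi j w.
have mS : measurable_fun [set: T] S by exact: measurable_linear_form.
(* A rotation needs a nonzero new coefficient; if it vanishes, the coordinate
   is integrated out by allowing it any value. *)
have [ai0|ai0] := eqVneq (a i) 0.
  exists r; first by rewrite sumi ai0 expr0n addr0.
  move=> B C mB mC.
  pose C' j := if j == i then setT else C j.
  have mC' j : measurable (C' j) by rewrite /C'; case: ifP.
  have := IH B C' mB mC'; rewrite prodi.
  rewrite [C' i](_ : _ = setT); last by rewrite /C' eqxx.
  rewrite probability_setT/= mul1r.
  rewrite (eq_bigr (fun j => fine (gamma (C j)))); last first.
    by move=> j; rewrite /C'; case: eqVneq => // ->; rewrite ltnn.
  move=> <-; congr (P (_ `&` _)); apply/seteqP; split => w /=.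
  - by rewrite sumi ai0 mul0r addr0.
  - by rewrite sumi ai0 mul0r addr0.
  - move=> wC j; rewrite lei /C'; case: eqVneq => //= _; exact: wC.
  - move=> wC j kj; have := wC j; rewrite lei kj orbT /C' => /(_ isT).
    by case: eqVneq kj => // ->; rewrite ltnn.
exists (Num.sqrt (r ^+ 2 + a i ^+ 2)).
  by rewrite sqr_sqrtr ?addr_ge0 ?sqr_ge0// sumi rE.
move=> B C mB mC.
pose E := [set w | forall j : 'I_m, (k.+1 <= j)%N -> C j (xi j w)].
have mE : measurable E by exact: measurable_trailing_box.
have mf : measurable_fun [set: T] (fun w => (S w, xi i w)).
  exact: measurable_fun_pair.
have mg : measurable_fun [set: R * R] (fun z : R * R => (r * z.1, z.2)).
  by apply: measurable_fun_pair => //; apply: measurable_funM.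
pose c := \prod_(j < m | (k.+1 <= j)%N) fine (gamma (C j)).
have c0 : 0 <= c by apply: prodr_ge0 => j _; exact: fine_ge0.
(* nu1 is the joint law of the partial sum and coordinate k on the event E. *)
pose nu1 := (pushforward (mrestr P mE) (fun w => (S w, xi i w))
  : {measure set (R * R) -> \bar R}).
pose nu2 := (mscale (NngNum c0)
  (pushforward (gamma \x gamma)%E (fun z : R * R => (r * z.1, z.2)))
  : {measure set (R * R) -> \bar R}).
have nuE : forall D, measurable D -> nu1 mf D = nu2 mg D.
  apply: finite_measure_eq_rectangles.
    rewrite /nu1/= /pushforward/= /mrestr preimage_setT setTI.
    by rewrite (le_lt_trans (probability_le1 P mE))// ltry.
  move=> X Y mX mY; rewrite /nu1/= /pushforward/= /mrestr.
  pose C' j := if j == i then Y else C j.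
  have mC' j : measurable (C' j) by rewrite /C'; case: ifP.
  have := IH X C' mX mC'; rewrite prodi.
  rewrite [C' i](_ : _ = Y); last by rewrite /C' eqxx.
  rewrite (eq_bigr (fun j => fine (gamma (C j)))); last first.
    by move=> j; rewrite /C'; case: eqVneq => // ->; rewrite ltnn.
  rewrite -/c => IHX.
  transitivity (gamma [set x | X (r * x)%R] * (fine (gamma Y) * c)%:E)%E.
    rewrite -IHX; congr (P _); apply/seteqP; split => w /=.
      move=> [[SX xY] wC]; split=> // j; rewrite lei /C'.
      by case: eqVneq => //= [->|] // _; exact: wC.
    move=> [SX wC]; split; first split=> //.
      by have := wC i (leqnn _); rewrite /C' eqxx.
    move=> j kj; have := wC j (ltnW kj); rewrite /C'.
    by case: eqVneq kj => // ->; rewrite ltnn.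
  rewrite /nu2/= /mscale/= /pushforward/=.
  have mrX : measurable [set x | X (r * x)].
    rewrite -[X in measurable X]setTI.
    have mr : measurable_fun [set: R] (fun x : R => r * x) by apply: measurable_funM.
    exact: mr.
  have -> : (fun z : R * R => (r * z.1, z.2)) @^-1` (X `*` Y) =
     [set x | X (r * x)] `*` Y by [].
  by rewrite product_measure1E// EFinM fine_gamma// muleA muleC.
pose D := [set z : R * R | B (z.1 + a i * z.2)].
have mD : measurable D.
  have mh : measurable_fun [set: R * R] (fun z : R * R => z.1 + a i * z.2).
    by apply: measurable_funD => //; apply: measurable_funM.
  by rewrite -[X in measurable X]setTI; exact: mh.
have := nuE D mD; rewrite /nu1 /nu2/= /mscale/= /pushforward/= /mrestr.
have -> : (fun w => (S w, xi i w)) @^-1` D =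
   [set w | B (\sum_(j < m | (j < k.+1)%N) a j * xi j w)].
  by apply/seteqP; split=> w /=; rewrite /D/= sumi.
move=> ->.
have -> : (fun z : R * R => (r * z.1, z.2)) @^-1` D =
  [set z | B (r * z.1 + a i * z.2)] by [].
rewrite (@standard_gaussian_rotation _ _ _ (Num.sqrt (r ^+ 2 + a i ^+ 2)))//.
  by rewrite muleC.
by rewrite sqr_sqrtr// addr_ge0 ?sqr_ge0.
Qed.

Lemma linear_form_law (a : 'I_m -> R) : exists2 r : R,
  r ^+ 2 = \sum_(j < m) a j ^+ 2 &
  forall B : set R, measurable B ->
  P [set w | B (\sum_(j < m) a j * xi j w)] = gamma [set x | B (r * x)].
Proof.
have [r rE H] := partial_linear_form_law a (leqnn m).
exists r; first by rewrite rE; apply: eq_bigl => j; rewrite ltn_ord.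
move=> B mB; have := H B (fun=> setT) mB (fun=> measurableT).
rewrite [X in (_ * X)%E](_ : _ = 1%E); last first.
  by rewrite big1// => j _; rewrite probability_setT.
rewrite mule1 => <-; congr (P _).
have sumE w : \sum_(j < m | (j < m)%N) a j * xi j w = \sum_(j < m) a j * xi j w.
  by apply: eq_bigl => j; rewrite ltn_ord.
by apply/seteqP; split => w /=; rewrite sumE// => -[].
Qed.

Lemma linear_form_tail (a : 'I_m -> R) (beta t : R) : 0 <= beta -> 0 <= t ->
  \sum_(j < m) a j ^+ 2 <= beta ^+ 2 ->
  (P [set w | (beta * t < `|\sum_(j < m) a j * xi j w|)%R] <=
   (expR (- t ^+ 2 / 2))%:E)%E.
Proof.
move=> b0 t0; have [r <- H] := linear_form_law a.
rewrite -[r ^+ 2]real_normK ?num_real// ler_sqr ?nnegrE// => rb.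
have mabs (u : R) : measurable [set x : R | u < `|x|].
  have mh : measurable_fun [set: R] (fun x : R => `|x|) by exact: normr_measurable.
  rewrite -[X in measurable X]setTI.
  have := mh measurableT `]u, +oo[%classic (measurable_itv _).
  by congr measurable; congr (_ `&` _); apply/seteqP; split=> x /=; rewrite in_itv/= andbT.
rewrite (H [set x | beta * t < `|x|])//.
apply: le_trans (normal_prob_two_sided_tail t0).
have mr : measurable_fun [set: R] (fun x : R => r * x) by apply: measurable_funM.
apply: le_measure; rewrite ?inE; [|exact: mabs|].
  rewrite -[X in measurable X]setTI; exact: (mr measurableT _ (mabs _)).
move=> x /=; rewrite normrM; apply: contraTT; rewrite -!leNgt => xt.
by apply: ler_pM.
Qed.

(** The exceptional event is chosen before any signal is considered, which makes
    the risk bounds uniform over signals. *)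
Lemma linear_forms_union_bound n (A : 'M[R]_(m, n)) (beta t : R) :
  0 <= beta -> 0 <= t ->
  (forall i, \sum_(j < m) A j i ^+ 2 <= beta ^+ 2) ->
  exists2 E : set T, measurable E /\ (P E <= (n%:R * expR (- t ^+ 2 / 2))%:E)%E &
  forall w, ~ E w -> forall i, `|\sum_(j < m) A j i * xi j w| <= beta * t.
Proof.
move=> b0 t0 Ab.
pose F i := [set w | beta * t < `|\sum_(j < m) A j i * xi j w|].
have mF i : measurable (F i).
  have mh : measurable_fun [set: T] (fun w => `|\sum_(j < m) A j i * xi j w|).
    by apply: measurableT_comp => //; exact: measurable_linear_form.
  rewrite -[X in measurable X]setTI.
  have := mh measurableT `]beta * t, +oo[%classic (measurable_itv _).
  by congr measurable; congr (_ `&` _); apply/seteqP; split=> x /=; rewrite in_itv/= andbT.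
exists (\big[setU/set0]_(i < n) F i); last first.
  move=> w wF i; rewrite leNgt; apply/negP => Fi; apply: wF.
  by rewrite -bigcup_seq; exists i => //=; rewrite mem_index_enum.
split; first exact: bigsetU_measurable.
have union_le (s : seq 'I_n) :
    (P (\big[setU/set0]_(i <- s) F i) <=
     ((size s)%:R * expR (- t ^+ 2 / 2))%:E)%E.
  elim: s => [|i s IHs]; first by rewrite big_nil measure0 mul0r.
  rewrite big_cons; apply: le_trans (measureU2 _ _ _) _ => //.
    exact: bigsetU_measurable.
  rewrite /= -addn1 natrD mulrDl mul1r addrC EFinD; apply: leeD => //.
  exact: linear_form_tail.
have := union_le (index_enum 'I_n).
by rewrite -sum1_size big_const_ord iter_addn_0 mul1n.
Qed.
End linear_forms.

(** * From the noise event to the risk *)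

(** The bad set of the risk is only measured by an outer measure, so any
    measurable event that contains it gives a bound. *)
Lemma risk_le_event (R : realType) (d : measure_display) (T : measurableType d)
    (P : probability T R) (m n s : nat) (A : 'M[R]_(m, n))
    (xi : 'I_m -> {RV P >-> R}) (xhat : 'cV[R]_m -> 'cV[R]_n) (p : \bar R)
    (eps sigma upsilon delta : R) (E : set T) :
  measurable E -> (P E <= eps%:E)%E ->
  (forall w x, ~ E w -> nearly_sparse s upsilon x ->
     lnorm p (xhat (A *m x + sigma *: \col_i xi i w) - x) <= delta) ->
  (risk A xi xhat p eps sigma s upsilon <= delta%:E)%E.
Proof.
move=> mE PE H; apply: ereal_inf_lbound => /=; exists delta => //.
apply: le_trans PE; rewrite -(measurable_mu_extE P mE); apply: le_mu_ext.
move=> w /= [x xs]; apply: contraPP => Ew; apply/negP; rewrite -leNgt.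
exact: H.
Qed.

Lemma lnorm2_sqr (R : realType) n (x : 'cV[R]_n) :
  lnorm 2%:E x ^+ 2 = \sum_(i < n) x i 0 ^+ 2.
Proof.
rewrite /lnorm -[LHS]powR_mulrn ?powR_ge0// -powRrM mulVf ?pnatr_eq0// powRr1.
  by apply: eq_bigr => i _; rewrite powR_mulrn// real_normK ?num_real.
by apply: sumr_ge0 => i _; exact: powR_ge0.
Qed.

Lemma max_col_norm_ge0 (R : realType) m n (A : 'M[R]_(m, n)) : 0 <= max_col_norm A.
Proof. by apply: bigmax_ge_id. Qed.

Lemma col_sqr_sum_le (R : realType) m n (A : 'M[R]_(m, n)) i :
  \sum_(j < m) A j i ^+ 2 <= max_col_norm A ^+ 2.
Proof.
rewrite (eq_bigr (fun j => col i A j 0 ^+ 2)); last by move=> j _; rewrite mxE.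
rewrite -lnorm2_sqr ler_sqr ?nnegrE ?max_col_norm_ge0 ?powR_ge0//.
exact: le_bigmax.
Qed.

(** With t^2 = 2 ln (n / eps) the union bound n exp(-t^2/2) equals eps. *)
Lemma risk_le_bounded_correlation (R : realType) (d : measure_display)
    (T : measurableType d) (P : probability T R) (m n s : nat) (A : 'M[R]_(m, n))
    (xi : 'I_m -> {RV P >-> R}) (xhat : 'cV[R]_m -> 'cV[R]_n) (p : \bar R)
    (eps sigma upsilon delta : R) :
  standard_gaussian xi -> (0 < n)%N -> 0 < eps -> eps < 1 -> 0 <= sigma ->
  (forall e x, (forall i, `|(A^T *m e) i 0| <=
        sigma * max_col_norm A * Num.sqrt (2 * ln (n%:R / eps))) ->
     nearly_sparse s upsilon x ->
     lnorm p (xhat (A *m x + e) - x) <= delta) ->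
  (risk A xi xhat p eps sigma s upsilon <= delta%:E)%E.
Proof.
move=> hxi n0 eps0 eps1 sigma0 H.
have n1 : 1 <= n%:R / eps.
  by rewrite ler_pdivlMr// mul1r (le_trans (ltW eps1))// ler1n.
have [E [mE PE] HE] := linear_forms_union_bound hxi (max_col_norm_ge0 A)
  (sqrtr_ge0 (2 * ln (n%:R / eps))) (col_sqr_sum_le A).
apply: (risk_le_event mE).
  apply: le_trans PE _; rewrite lee_fin sqr_sqrtr ?mulr_ge0 ?ln_ge0//.
  rewrite -mulrN [_ / 2]mulrC mulKf ?pnatr_eq0// expRN lnK ?posrE; last first.
    by rewrite divr_gt0// ltr0n.
  by rewrite invf_div mulrCA divff ?mulr1// pnatr_eq0 -lt0n.
move=> w x wE xs; apply: H => // i.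
rewrite mxE (_ : \sum_j _ = sigma * \sum_(j < m) A j i * xi j w); last first.
  by rewrite mulr_sumr; apply: eq_bigr => j _; rewrite !mxE mulrCA.
rewrite normrM ger0_norm// -mulrA ler_wpM2l//; exact: HE.
Qed.

(** * Leading entries of a vector *)

Section leading_entries.
Context {R : realType} {n : nat}.
Implicit Types (x z : 'cV[R]_n) (i j : 'I_n).

Definition rank x i : nat := #|[set j | precedes x j i]%SET|.

Definition leading s x : pred 'I_n := fun i => (rank x i < s)%N.

Lemma precedes_irr x i : precedes x i i = false.
Proof. by rewrite /precedes ltxx eqxx ltnn. Qed.

Lemma precedes_trans x : transitive (precedes x).
Proof.
move=> j i k /orP[ij|/andP[/eqP ij lij]] /orP[jk|/andP[/eqP jk ljk]].
- by rewrite /precedes (lt_trans jk ij).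
- by rewrite /precedes -jk ij.
- by rewrite /precedes ij jk.
- by rewrite /precedes ij jk eqxx (ltn_trans lij ljk) orbT.
Qed.

Lemma precedes_total x i j : i != j -> precedes x i j || precedes x j i.
Proof.
move=> ij; rewrite /precedes; case: (ltgtP `|x i 0| `|x j 0|) => //= _.
by rewrite -neq_ltn.
Qed.

Lemma precedes_rank x i j : precedes x i j -> (rank x i < rank x j)%N.
Proof.
move=> ij; apply: proper_card; apply/properP; split.
  by apply/fintype.subsetP => k; rewrite !inE => /precedes_trans; exact.
by exists i; rewrite !inE ?precedes_irr.
Qed.

Lemma rank_lt x i : (rank x i < n)%N.
Proof.
rewrite -[X in (_ < X)%N]card_ord -cardsT; apply: proper_card.
by apply/properP; split=> //; exists i; rewrite !inE ?precedes_irr.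
Qed.

(** Since [precedes] is a strict total order, the rank is a permutation of the
    indices; this makes the number of leading entries exactly s for s <= n, ties included. *)
Lemma rank_inj x : injective (rank x).
Proof.
move=> i j ij; apply/eqP; apply/negPn/negP => /(precedes_total x).
by move=> /orP[] /precedes_rank; rewrite ij ltnn.
Qed.

Lemma card_leading s x : (s <= n)%N -> #|leading s x| = s.
Proof.
move=> sn; pose f i := Ordinal (rank_lt x i).
have f_inj : injective f by move=> i j [/rank_inj].
transitivity (\sum_(k < n | (k < s)%N) 1)%N; last first.
  by rewrite -(big_ord_widen _ (fun=> 1%N) sn) sum1_card card_ord.
by rewrite -sum1_card [RHS](reindex f)//; exact/onW_bij/injF_bij.
Qed.

(** A magnitude that separates leading from other entries; it replaces any sorting
    of the entries in what follows. *)
Lemma leading_threshold s z : exists tau : R,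
  [/\ 0 <= tau, forall i, leading s z i -> tau <= `|z i 0| &
      forall i, ~~ leading s z i -> `|z i 0| <= tau].
Proof.
exists (\big[Num.max/0]_(i < n | ~~ leading s z i) `|z i 0|); split.
- exact: bigmax_ge_id.
- move=> j lj; apply: bigmax_le => // i li; rewrite leNgt; apply/negP => ji.
  move: li; rewrite /leading -leqNgt leqNgt => /negP; apply.
  by apply: ltn_trans lj; apply: precedes_rank; rewrite /precedes ji.
- by move=> i li; exact: le_bigmax_cond.
Qed.

(** Exchange argument: indices of J that are not leading are at most as many as
    leading indices outside J, and the threshold separates their magnitudes. *)
Lemma sum_le_sum_leading s z (J : pred 'I_n) : (s <= n)%N -> (#|J| <= s)%N ->
  \sum_(i < n | J i) `|z i 0| <= \sum_(i < n | leading s z i) `|z i 0|.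
Proof.
move=> sn Js; have [tau [tau0 lead out]] := leading_threshold s z.
pose L := leading s z.
rewrite (bigID L J)/= [leRHS](bigID J)/=.
rewrite (eq_bigl (fun i => L i && J i)); last by move=> i; rewrite andbC.
rewrite lerD2l; apply: (@le_trans _ _ (\sum_(i < n | J i && ~~ L i) tau)).
  by apply: ler_sum => i /andP[_ /out].
apply: (@le_trans _ _ (\sum_(i < n | L i && ~~ J i) tau)); last first.
  by apply: ler_sum => i /andP[/lead].
rewrite !sumr_const ler_wpMn2l//.
have cL : #|L| = s by exact: card_leading.
rewrite -(leq_add2l #|[pred i | L i && J i]|).
have -> : (#|[pred i | L i && J i]| + #|[pred i | L i && ~~ J i]|)%N = s.
  by rewrite -cL -[in RHS](cardID J L); congr (_ + _)%N; apply: eq_card => i;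
     rewrite !inE// andbC.
apply: leq_trans Js; rewrite -(cardID L J); apply: eq_leq.
by congr (_ + _)%N; apply: eq_card => i; rewrite !inE// andbC.
Qed.

Lemma lnorm1E x : lnorm 1%E x = \sum_(i < n) `|x i 0|.
Proof.
rewrite /lnorm invr1 powRr1; first by apply: eq_bigr => i _; rewrite powRr1.
by apply: sumr_ge0 => i _; exact: powR_ge0.
Qed.

Lemma nearly_sparseE s v x :
  nearly_sparse s v x = (\sum_(i < n | ~~ leading s x i) `|x i 0| <= v).
Proof.
transitivity (is_true (lnorm 1%E (x - truncate s x) <= v)) => //.
rewrite lnorm1E [in RHS]big_mkcond/=; congr (is_true (_ <= _)).
apply: eq_bigr => i _; rewrite !mxE -/(rank x i) -/(leading s x i).
by case: (leading s x i); rewrite ?subrr ?normr0// subr0.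
Qed.

(** With I the leading set of x, the triangle inequality gives
    |xh_i| >= |x_i| - |z_i| on I and |xh_i| >= |z_i| - |x_i| off I.  Summing,
    the mass of z off I is paid for by its mass on I, the tail of x and the gain
    in l1 norm; the mass of z on I is at most that on the leading set of z. *)
Lemma l1_cone s v x xh : (s <= n)%N -> nearly_sparse s v x ->
  lnorm 1%E (xh - x) <=
    2 * \sum_(i < n | leading s (xh - x) i) `|(xh - x) i 0| + 2 * v
    + (lnorm 1%E xh - lnorm 1%E x).
Proof.
move=> sn; rewrite nearly_sparseE !lnorm1E; set z := xh - x => xv.
have := sum_le_sum_leading z sn (eq_leq (card_leading x sn)).
set I := leading s x in xv * => zI.
have H : \sum_(i < n) (`|x i 0| + `|z i 0|) <=
   \sum_(i < n) (`|xh i 0| + (if I i then 2 * `|z i 0| else 2 * `|x i 0|)).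
  apply: ler_sum => i _.
  have -> : xh i 0 = z i 0 + x i 0 by rewrite !mxE subrK.
  case: ifP => _.
    have := ler_normB (z i 0 + x i 0) (z i 0).
    by rewrite addrAC subrr add0r; lra.
  have := ler_normB (z i 0 + x i 0) (x i 0).
  by rewrite addrK; lra.
have split_sum (F : 'I_n -> R) :
    \sum_i F i = \sum_(i | I i) F i + \sum_(i | ~~ I i) F i by exact: bigID.
have := split_sum (fun i => if I i then 2 * `|z i 0| else 2 * `|x i 0|).
rewrite [X in _ = X + _](eq_bigr (fun i => 2 * `|z i 0|)); last by move=> i ->.
rewrite [X in _ = _ + X](eq_bigr (fun i => 2 * `|x i 0|)); last first.
  by move=> i /negbTE ->.
rewrite -!mulr_sumr; move: H; rewrite !big_split/=; lra.
Qed.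
End leading_entries.

(** * Norms of truncations *)

Section truncated_norms.
Context {R : realType} {n : nat}.
Implicit Types (z : 'cV[R]_n) (i j : 'I_n).

Lemma fine_inve_EFin (b : R) : 0 < b -> fine ((b%:E)^-1)%E = b^-1.
Proof. by move=> b0; rewrite inver gt_eqF. Qed.

Lemma powR_weighted_amgm (t r b : R) : 0 <= t -> 0 < r -> r <= b ->
  t `^ r <= r / b * t `^ b + (1 - r / b).
Proof.
move=> t0 r0; rewrite le_eqVlt => /predU1P[<-|rb].
  by rewrite divff ?gt_eqF// mul1r subrr addr0.
have b0 : 0 < b by exact: lt_trans rb.
have q0 : 0 < 1 - r / b by rewrite subr_gt0 ltr_pdivrMr// mul1r.
have := @conjugate_powR R (t `^ r) 1 (b / r) (1 - r / b)^-1 (powR_ge0 _ _) ler01.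
rewrite divr_gt0// invr_gt0 q0 invrK invf_div => /(_ isT isT).
rewrite -powRrM powR1 mulr1 mul1r (_ : r * (b / r) = b); last by field; rewrite gt_eqF.
rewrite [t `^ b * _]mulrC; apply; ring.
Qed.

Lemma trunc_norm_fin (s : nat) (b : R) z : 0 < b ->
  trunc_norm s b%:E z =
  (\sum_(i < n | leading s z i) `|z i 0| `^ b) `^ b^-1.
Proof.
move=> b0; rewrite /trunc_norm /lnorm; congr (_ `^ _).
rewrite [RHS]big_mkcond/=; apply: eq_bigr => i _.
rewrite mxE -/(rank z i) -/(leading s z i).
by case: (leading s z i) => //; rewrite normr0 powR0// gt_eqF.
Qed.

Lemma le_trunc_norm_infty (s : nat) z i : leading s z i ->
  `|z i 0| <= trunc_norm s +oo%E z.
Proof.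
move=> li; have := @le_bigmax _ R 'I_n 0 (fun i => `|truncate s z i 0|) i.
by rewrite mxE -/(rank z i) -/(leading s z i) li.
Qed.

(** Power means over the s leading entries.  After division by W, the weighted
    inequality t^r <= (r/b) t^b + 1 - r/b is summed term by term. *)
Lemma leading_moment (s : nat) (q : \bar R) (W r : R) z :
  (0 < s)%N -> (s <= n)%N -> 0 < W -> 0 < r -> (r%:E <= q)%E ->
  trunc_norm s q z <= s%:R `^ (fine q^-1%E) * W ->
  \sum_(i < n | leading s z i) `|z i 0| `^ r <= s%:R * W `^ r.
Proof.
move=> s0 sn W0 r0 rq zW.
have sE (c : R) : \sum_(i < n | leading s z i) c = s%:R * c.
  by rewrite sumr_const (card_leading z sn) mulr_natl.
case: q rq zW => [b| |//]; last first.
  rewrite invey/= powRr0 mul1r => _ zW; rewrite -sE; apply: ler_sum => i li.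
  apply: ge0_ler_powR; rewrite ?nnegrE ?(ltW W0) ?(ltW r0)//.
  exact: le_trans (le_trunc_norm_infty li) zW.
rewrite lee_fin => rb; have b0 : 0 < b by exact: lt_le_trans rb.
rewrite trunc_norm_fin// fine_inve_EFin// => zW.
have zWb : \sum_(i < n | leading s z i) `|z i 0| `^ b <= s%:R * W `^ b.
  have := ge0_ler_powR (ltW b0) _ _ zW.
  rewrite !nnegrE powR_ge0 mulr_ge0 ?powR_ge0 ?(ltW W0)// => /(_ isT isT).
  rewrite -powRrM mulVf ?gt_eqF// powRr1; last first.
    by apply: sumr_ge0 => i _; exact: powR_ge0.
  by rewrite powRM ?powR_ge0 ?(ltW W0)// -powRrM mulVf ?gt_eqF// powRr1 ?ler0n.
have WE i (a : R) : `|z i 0| `^ a = W `^ a * (`|z i 0| / W) `^ a.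
  by rewrite -powRM ?divr_ge0 ?(ltW W0)// mulrCA divff ?mulr1// gt_eqF.
rewrite (eq_bigr _ (fun i _ => WE i r)) -mulr_sumr mulrC ler_pM2r ?powR_gt0//.
move: zWb; rewrite (eq_bigr _ (fun i _ => WE i b)) -mulr_sumr mulrC ler_pM2r ?powR_gt0// => zWb.
apply: (@le_trans _ _ (\sum_(i < n | leading s z i)
    (r / b * (`|z i 0| / W) `^ b + (1 - r / b)))).
  by apply: ler_sum => i _; apply: powR_weighted_amgm; rewrite ?divr_ge0// ltW.
rewrite big_split/= sE -mulr_sumr.
have rb0 : 0 <= r / b by rewrite divr_ge0// ltW.
have := ler_wpM2l rb0 zWb; lra.
Qed.

(** The first moment of the leading entries puts the threshold, hence every other
    entry, below W.  So the other entries contribute at most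
    W^(p-1) times their l1 norm to the sum of p-th powers. *)
Lemma lnorm_le_of_trunc_norm (s : nat) (p q : \bar R) (W : R) z :
  (0 < s)%N -> (s <= n)%N -> 0 < W -> (1 <= p)%E -> (p <= q)%E ->
  trunc_norm s q z <= s%:R `^ (fine q^-1%E) * W ->
  lnorm 1%E z <= 2 * s%:R * W ->
  lnorm p z <= (3 * s)%:R `^ (fine p^-1%E) * W.
Proof.
move=> s0 sn W0 p1 pq zW; rewrite lnorm1E => zN.
have [tau [tau0 lead out]] := leading_threshold s z.
have q1 : (1 <= q)%E by exact: le_trans pq.
have sR : 0 < s%:R :> R by rewrite ltr0n.
have tauW : tau <= W.
  have := leading_moment s0 sn W0 ltr01 q1 zW; rewrite powRr1 ?(ltW W0)// => H.
  rewrite -(ler_pM2l sR); apply: le_trans H.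
  apply: (@le_trans _ _ (\sum_(i < n | leading s z i) tau)).
    by rewrite sumr_const (card_leading z sn) mulr_natl.
  by apply: ler_sum => i /lead; rewrite powRr1.
have outW i : ~~ leading s z i -> `|z i 0| <= W by move=> /out/le_trans; exact.
case: p p1 pq => [r| |//]; last first.
  rewrite leye_eq => _ /eqP qE; subst q; rewrite invey/= powRr0 mul1r.
  apply: bigmax_le => [|i _]; first exact: ltW.
  have [li|/outW//] := boolP (leading s z i).
  by apply: le_trans (le_trunc_norm_infty li) _; move: zW; rewrite invey/= powRr0 mul1r.
rewrite !lee_fin => r1 rq; have r0 : 0 < r by exact: lt_le_trans r1.
rewrite fine_inve_EFin// /lnorm.
(* 3 s = s + 2 s: leading entries and all others. *)
have H : \sum_(i < n) `|z i 0| `^ r <= (3 * s)%:R * W `^ r.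
  rewrite (bigID (leading s z))/= natrM.
  have -> : 3%:R * s%:R * W `^ r = s%:R * W `^ r + W `^ (r - 1) * (2 * s%:R * W).
    by rewrite -(mulr_powRB1 (ltW W0) r0); ring.
  apply: lerD; first exact: leading_moment zW.
  apply: (@le_trans _ _ (\sum_(i < n | ~~ leading s z i) W `^ (r - 1) * `|z i 0|)).
    apply: ler_sum => i li; rewrite -mulr_powRB1// mulrC ler_wpM2r//.
    by apply: ge0_ler_powR; rewrite ?nnegrE ?subr_ge0 ?(ltW W0)// outW.
  rewrite -mulr_sumr ler_wpM2l ?powR_ge0//; apply: le_trans zN.
  by rewrite [leRHS](bigID (leading s z))/= lerDr sumr_ge0.
have sum0 : 0 <= \sum_(i < n) `|z i 0| `^ r.
  by apply: sumr_ge0 => i _; exact: powR_ge0.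
have ri0 : 0 <= r^-1 by rewrite invr_ge0 ltW.
apply: (le_trans (ge0_ler_powR ri0 _ _ H)).
- by rewrite nnegrE.
- by rewrite nnegrE mulr_ge0// powR_ge0.
rewrite powRM ?powR_ge0// -powRrM mulfV ?gt_eqF//.
by rewrite powRr1 ?(ltW W0).
Qed.
End truncated_norms.

(** * Quadratic estimates *)

Section quadratic_estimates.
Variable R : realFieldType.
Implicit Types (S lambda kappa r v N u W : R).

(** Here S is the sparsity, u the Euclidean norm of A z and N the l1 norm of z.
    Weighted arithmetic-geometric mean applied to lambda S u with u^2 <= r N
    absorbs half of (1 - 2 kappa) N, which bounds N.  Reinserting this bound
    gives lambda u <= (1 - 2 kappa) W, and kappa N / S <= 2 kappa W completes W
    exactly. *)
Lemma dantzig_estimate S lambda kappa r v N u W :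
  0 < S -> 0 < lambda -> 0 < kappa -> 0 < 1 - 2 * kappa -> 0 < r -> 0 <= v ->
  0 <= N -> 0 <= u ->
  (1 - 2 * kappa) * N <= 2 * lambda * S * u + 2 * v -> u ^+ 2 <= r * N ->
  W = (2 * S * lambda ^+ 2 * r / (1 - 2 * kappa) + 2 * (S^-1 * v)) / (1 - 2 * kappa) ->
  N <= 2 * S * W /\ lambda * u + kappa * N / S <= W.
Proof.
move=> S0 l0 kap0; have [k kE] : exists k, k = 1 - 2 * kappa by eexists.
rewrite -kE => k0 r0 v0 N0 u0 kN uN WE.
(* k and B are given by equations, so that [field] and [lra] see atoms. *)
have [B BE] : exists B, B = 2 * S * lambda ^+ 2 * r / k by eexists.
rewrite -BE in WE.
have B0 : 0 < B by rewrite BE !mulr_gt0 ?invr_gt0 ?exprn_gt0.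
have kW : k * W = B + 2 * (S^-1 * v) by rewrite WE mulrC divfK ?gt_eqF.
have SV : S * (S^-1 * v) = v by rewrite mulVKf// gt_eqF.
have V0 : 0 <= S^-1 * v by rewrite mulr_ge0// invr_ge0 ltW.
have BkW : B <= k * W by rewrite kW; lra.
have N2 : N <= 2 * S * W.
  have amgm : 2 * lambda * S * u <= k / 2 * N + S * B.
    have uu : k / (2 * r) * u ^+ 2 <= k / 2 * N.
      have := ler_wpM2l (_ : 0 <= k / (2 * r)) uN.
      rewrite (_ : k / (2 * r) * (r * N) = k / 2 * N); last by field; rewrite gt_eqF.
      by apply; rewrite divr_ge0 ?mulr_ge0// ltW.
    (* The square vanishes at the minimizer of k/(2r) u^2 - 2 lambda S u. *)
    have sq : 0 <= k / (2 * r) * (u - 2 * r * lambda * S / k) ^+ 2.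
      by rewrite mulr_ge0 ?sqr_ge0// divr_ge0 ?mulr_ge0// ltW.
    have sqE : k / (2 * r) * (u - 2 * r * lambda * S / k) ^+ 2 =
        k / (2 * r) * u ^+ 2 - 2 * lambda * S * u + S * B.
      by rewrite BE; field; rewrite !gt_eqF.
    by move: sq; rewrite sqE; lra.
  have kN2 : k * N <= k * (2 * S * W).
    rewrite (_ : k * (2 * S * W) = 2 * S * (k * W)); last by ring.
    rewrite kW (_ : 2 * S * (B + _) = 2 * (S * B) + 4 * (S * (S^-1 * v))); last by ring.
    by rewrite SV; lra.
  by move: kN2; rewrite ler_pM2l.
split=> //.
have W0 : 0 < W by rewrite -(pmulr_rgt0 _ k0) (lt_le_trans B0).
have lu : lambda * u <= k * W.
  rewrite -ler_sqr ?nnegrE ?mulr_ge0 ?(ltW l0) ?(ltW k0) ?(ltW W0)//.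
  rewrite exprMn; apply: (@le_trans _ _ (lambda ^+ 2 * (r * (2 * S * W)))).
    rewrite ler_wpM2l ?sqr_ge0//; apply: le_trans uN _; exact: ler_wpM2l (ltW r0) _ _ N2.
  rewrite (_ : _ * _ = B * (k * W)); last by rewrite BE; field; rewrite gt_eqF.
  by rewrite expr2 ler_wpM2r// mulr_ge0// ltW.
have kNS : kappa * N / S <= kappa * (2 * W).
  rewrite -mulrA ler_wpM2l ?(ltW kap0)// ler_pdivrMr//.
  by move: N2; rewrite mulrAC.
have -> : W = k * W + kappa * (2 * W) by rewrite kE; ring.
exact: lerD.
Qed.

(** Write f = lambda u, B = 2 S lambda^2 / varkappa and V = v / S.  Divided by S,
    the hypothesis reads k N / S <= 2 f - 2 f^2 / B + 2 V, with k the coefficient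
    of N.  Its right side is at most B + 2 V, which bounds N; it is nonnegative,
    which forces f <= B + V.  The second conclusion follows from
    (1 - 2 kappa) (B + V) + kappa (B + 2 V) <= B + V. *)
Lemma lasso_estimate S lambda kappa varkappa rho v N u W :
  0 < S -> 0 < lambda -> 0 < kappa -> 0 < varkappa -> 0 <= rho ->
  0 < 1 - 2 * kappa - 2 * rho * varkappa -> 0 <= v ->
  0 <= N -> 0 <= u ->
  (1 - 2 * kappa - 2 * rho * varkappa) * N + varkappa * u ^+ 2 <=
    2 * lambda * S * u + 2 * v ->
  W = (2 * S * lambda ^+ 2 / varkappa + S^-1 * v) /
      (1 - 2 * kappa - 2 * rho * varkappa) ->
  N <= 2 * S * W /\ lambda * u + kappa * N / S <= W.
Proof.
move=> S0 l0 kap0 vk0 rho0.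
have [k kE] : exists k, k = 1 - 2 * kappa - 2 * rho * varkappa by eexists.
rewrite -kE => k0 v0 N0 u0 H WE.
have [B BE] : exists B, B = 2 * S * lambda ^+ 2 / varkappa by eexists.
have [V VE] : exists V, V = S^-1 * v by eexists.
rewrite -BE -VE in WE.
have B0 : 0 < B by rewrite BE !mulr_gt0 ?invr_gt0 ?exprn_gt0.
have kW : k * W = B + V by rewrite WE mulrC divfK ?gt_eqF.
have SV : S * V = v by rewrite VE mulVKf// gt_eqF.
have V0 : 0 <= V by rewrite VE mulr_ge0// invr_ge0 ltW.
have [f fE] : exists f, f = lambda * u by eexists.
have f0 : 0 <= f by rewrite fE mulr_ge0// ltW.
have H1 : k * (N / S) <= 2 * f - 2 * f ^+ 2 / B + 2 * V.
  rewrite -(ler_pM2l S0) (_ : S * (k * (N / S)) = k * N); last first.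
    by field; rewrite gt_eqF.
  rewrite mulrDr mulrBr (_ : S * (2 * f ^+ 2 / B) = varkappa * u ^+ 2); last first.
    by rewrite BE fE; field; rewrite !gt_eqF.
  rewrite (mulrCA S 2 V) SV fE (_ : S * (2 * (lambda * u)) = 2 * lambda * S * u); last by ring.
  by lra.
have NS0 : 0 <= N / S by rewrite divr_ge0// ltW.
have fB : 2 * f - 2 * f ^+ 2 / B <= B.
  rewrite -subr_ge0 (_ : _ - _ = ((f - B) ^+ 2 + f ^+ 2) / B); last first.
    by field; rewrite gt_eqF.
  by rewrite divr_ge0 ?(ltW B0)// addr_ge0 ?sqr_ge0.
have kNS0 : 0 <= k * (N / S) by rewrite mulr_ge0// ltW.
have NSW : k * (N / S) <= 2 * (k * W) by rewrite kW; lra.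
split.
  by move: NSW; rewrite [2 * _]mulrCA ler_pM2l// ler_pdivrMr// mulrAC.
rewrite -fE -(ler_pM2l k0) kW mulrDr.
have fBV : f <= B + V.
  rewrite leNgt; apply/negP => lt.
  have : B * (k * (N / S)) <= B * (2 * f - 2 * f ^+ 2 / B + 2 * V).
    by rewrite ler_pM2l.
  rewrite (_ : B * (2 * f - 2 * f ^+ 2 / B + 2 * V) =
     2 * (B * f + B * V - f ^+ 2)); last by field; rewrite gt_eqF.
  have : 0 <= B * (k * (N / S)) by rewrite mulr_ge0// ltW.
  have : B * V <= f * V by rewrite ler_wpM2r//; lra.
  have f_gt0 : 0 < f by lra.
  have : f * (B + V) < f ^+ 2 by rewrite expr2 ltr_pM2l.
  by rewrite mulrDr (mulrC f B); lra.
have kf : k * f <= (1 - 2 * kappa) * f.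
  by rewrite ler_wpM2r// kE lerBlDr lerDl !mulr_ge0// ltW.
have kk : k * (kappa * N / S) <= kappa * (B + 2 * V).
  rewrite (_ : k * (kappa * N / S) = kappa * (k * (N / S))); last by ring.
  by rewrite ler_wpM2l ?(ltW kap0)//; lra.
have kappa1 : 0 <= 1 - 2 * kappa.
  have : 0 <= rho * varkappa by rewrite mulr_ge0// ltW.
  by move: k0; rewrite kE; lra.
have := ler_wpM2l kappa1 fBV.
have := mulr_ge0 (ltW kap0) (ltW B0).
lra.
Qed.
End quadratic_estimates.

(** * Error bounds under bounded correlations *)

Section recovery.
Context {R : realType} {m n : nat}.
Implicit Types (A : 'M[R]_(m, n)) (z x xh : 'cV[R]_n) (e : 'cV[R]_m).

Lemma lnorm1_ge0 k (z : 'cV[R]_k) : 0 <= lnorm 1%E z.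
Proof. by rewrite lnorm1E sumr_ge0. Qed.

Lemma dot_mulmx A z e :
  \sum_i (A *m z) i 0 * e i 0 = \sum_j z j 0 * (A^T *m e) j 0.
Proof.
transitivity (((A *m z)^T *m e) 0 0).
  by rewrite mxE; apply: eq_bigr => i _; rewrite [_^T _ _]mxE.
by rewrite trmx_mul -mulmxA mxE; apply: eq_bigr => i _; rewrite [z^T _ _]mxE.
Qed.

(** Duality of the l1 and supremum norms.  It serves with e the noise, and with
    A z itself in the place of e to bound the Euclidean norm of A z. *)
Lemma dot_mulmx_le A z e (r : R) : (forall j, `|(A^T *m e) j 0| <= r) ->
  `|\sum_i (A *m z) i 0 * e i 0| <= r * lnorm 1%E z.
Proof.
move=> er; rewrite dot_mulmx lnorm1E mulr_sumr.
apply: le_trans (ler_norm_sum _ _ _) _; apply: ler_sum => j _.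
by rewrite normrM mulrC ler_wpM2r.
Qed.

Lemma le_lnorm_infty k (y : 'cV[R]_k) i : `|y i 0| <= lnorm +oo%E y.
Proof. exact: (le_bigmax 0 (fun i => `|y i 0|)). Qed.

Lemma lnorm_infty_le k (y : 'cV[R]_k) (r : R) : 0 <= r ->
  (forall i, `|y i 0| <= r) -> lnorm +oo%E y <= r.
Proof. by move=> r0 yr; apply: bigmax_le. Qed.

Lemma lnorm2_sqrN k (a : 'cV[R]_k) : lnorm 2%:E (- a) ^+ 2 = lnorm 2%:E a ^+ 2.
Proof.
apply: etrans (lnorm2_sqr _) _; apply: etrans _ (esym (lnorm2_sqr _)).
by apply: eq_bigr => i _; rewrite mxE sqrrN.
Qed.

Lemma lnorm2_sqrB k (a b : 'cV[R]_k) : lnorm 2%:E (a - b) ^+ 2 =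
  lnorm 2%:E a ^+ 2 - 2 * \sum_i a i 0 * b i 0 + lnorm 2%:E b ^+ 2.
Proof.
apply: etrans (lnorm2_sqr _) _.
transitivity (\sum_i a i 0 ^+ 2 - 2 * (\sum_i a i 0 * b i 0) + \sum_i b i 0 ^+ 2).
  rewrite mulr_sumr -sumrB -big_split/=; apply: eq_bigr => i _.
  by rewrite !mxE; ring.
by congr (_ - _ + _); exact: esym (lnorm2_sqr _).
Qed.

Lemma powR_inve_le (c : R) (p : \bar R) : 1 <= c -> (1 <= p)%E ->
  c `^ (fine p^-1%E) <= c.
Proof.
move=> c1 p1; rewrite -[leRHS]powRr1 ?(le_trans ler01)//; apply: ler_powR => //.
case: p p1 => [r| |//]; last by rewrite invey.
rewrite lee_fin => r1; have r0 : 0 < r by exact: lt_le_trans r1.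
by rewrite fine_inve_EFin// invf_le1.
Qed.

Lemma powR_inve_3mul_le (k : nat) (p : \bar R) : (1 <= p)%E ->
  (3 * k)%:R `^ (fine p^-1%E) <= 4 * k%:R `^ (fine p^-1%E) :> R.
Proof.
move=> p1; rewrite natrM powRM ?ler0n// ler_wpM2r ?powR_ge0//.
by apply: le_trans (powR_inve_le _ p1) _; rewrite ?ler1n ?ler_nat.
Qed.

Definition sparse_norm_condition A s (q : \bar R) (lambda kappa : R) : Prop :=
  forall x : 'cV[R]_n,
    trunc_norm s q x <=
      lambda * s%:R `^ (fine q^-1%E) * lnorm 2%:E (A *m x)
      + kappa * s%:R `^ (fine q^-1%E - 1) * lnorm 1%E x.

Variables (A : 'M[R]_(m, n)) (s : nat) (q : \bar R) (lambda kappa : R).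
Hypotheses (s_gt0 : (0 < s)%N) (s_le : (s <= n)%N) (q_ge1 : (1 <= q)%E).
Hypotheses (lambda_gt0 : 0 < lambda) (kappa_gt0 : 0 < kappa)
  (kappa_lt : kappa < 1 / 2).
Hypothesis hA : sparse_norm_condition A s q lambda kappa.

Let sR : 0 < s%:R :> R. Proof. by rewrite ltr0n. Qed.

Lemma trunc_norm_le z : trunc_norm s q z <= s%:R `^ (fine q^-1%E) *
  (lambda * lnorm 2%:E (A *m z) + kappa * lnorm 1%E z / s%:R).
Proof.
apply: le_trans (hA z) _; rewrite powRB; last by rewrite pnatr_eq0 -lt0n s_gt0 implybT.
rewrite powRr1 ?ler0n//.
by rewrite le_eqVlt; apply/orP; left; apply/eqP; ring.
Qed.

(** The case r = 1 of the power mean inequality, applied to the norm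
    condition. *)
Lemma sum_leading_le z : \sum_(i < n | leading s z i) `|z i 0| <=
  lambda * s%:R * lnorm 2%:E (A *m z) + kappa * lnorm 1%E z.
Proof.
have [N0|N0] := eqVneq (lnorm 1%E z) 0.
  apply: (@le_trans _ _ (lnorm 1%E z)).
    by rewrite lnorm1E [leRHS](bigID (leading s z))/= lerDl sumr_ge0.
  by rewrite N0 mulr0 addr0 !mulr_ge0 ?powR_ge0 ?ltW.
have N_gt0 : 0 < lnorm 1%E z by rewrite lt_def N0 lnorm1_ge0.
set u := lnorm 2%:E (A *m z); set N := lnorm 1%E z in N0 N_gt0 *.
have u0 : 0 <= u by exact: powR_ge0.
have W0 : 0 < lambda * u + kappa * N / s%:R.
  by rewrite ltr_wpDl ?mulr_ge0 ?(ltW lambda_gt0)// divr_gt0// mulr_gt0.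
have := leading_moment s_gt0 s_le W0 ltr01 q_ge1 (trunc_norm_le z).
rewrite powRr1 ?(ltW W0)// mulrDr [_ * (_ / _)]mulrC divfK ?gt_eqF//.
rewrite (_ : s%:R * (lambda * u) = lambda * s%:R * u); last by ring.
apply: le_trans; apply: ler_sum => i _; by rewrite powRr1.
Qed.

(** A zero matrix would contradict the norm condition at a basis vector, whose
    leading l1 norm and l1 norm are both one while kappa < 1.  This makes varrho
    positive. *)
Lemma max_col_norm_gt0 : 0 < max_col_norm A.
Proof.
rewrite lt_def max_col_norm_ge0 andbT; apply/negP => /eqP A0.
have n_gt0 : (0 < n)%N by exact: leq_trans s_le.
pose i0 := Ordinal n_gt0.
have Az : A *m delta_mx i0 0 = 0 :> 'cV[R]_m.
  rewrite -colE; apply/matrixP => j k; rewrite !mxE.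
  have := col_sqr_sum_le A i0; rewrite A0 expr0n/= => Aj; apply/eqP.
  rewrite -sqrf_eq0 eq_le sqr_ge0 andbT; apply: le_trans Aj.
  by rewrite (bigD1 j)//= lerDl sumr_ge0// => *; exact: sqr_ge0.
pose z : 'cV[R]_n := delta_mx i0 0.
have zE i : `|z i 0| = (i == i0)%:R by rewrite mxE andbT normr_nat.
have zN : lnorm 1%E z = 1.
  rewrite lnorm1E (bigD1 i0)//= zE eqxx big1 ?addr0// => i /negbTE ii0.
  by rewrite zE ii0.
have := sum_leading_le z; rewrite Az zN mulr1.
have -> : lnorm 2%:E (0 : 'cV[R]_m) = 0.
  by apply/eqP; rewrite -sqrf_eq0 lnorm2_sqr big1// => i _; rewrite mxE expr0n.
rewrite mulr0 add0r.
have := @sum_le_sum_leading _ _ s z (pred1 i0) s_le.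
rewrite card1 big_pred1_eq zE eqxx mulr1n => /(_ s_gt0); move: kappa_lt; lra.
Qed.

(** The inequality common to both recoveries; they differ only in how optimality
    bounds the last difference. *)
Lemma l1_error_bound v x xh : nearly_sparse s v x ->
  (1 - 2 * kappa) * lnorm 1%E (xh - x) <=
  2 * lambda * s%:R * lnorm 2%:E (A *m (xh - x)) + 2 * v
  + (lnorm 1%E xh - lnorm 1%E x).
Proof.
move=> xv; have := l1_cone xh s_le xv; have := sum_leading_le (xh - x).
move: (\sum_(i < n | _) _) (lnorm 1%E (xh - x)) (lnorm 2%:E _) => L N u.
by move: (lnorm 1%E xh - lnorm 1%E x) => D; lra.
Qed.

(** The true signal is feasible because its residual is the noise and
    varrho <= rho, so the l1 norm does not increase.  The
    residuals of xh and x have correlations at most rho and varrho with the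
    columns, so A^T A z is at most rho + varrho entrywise, and pairing with z
    bounds the square of the Euclidean norm of A z. *)
Lemma dantzig_selector_error (rho varrho v : R) (p : \bar R) x xh e :
  0 < varrho -> varrho <= rho -> (1 <= p)%E -> (p <= q)%E -> 0 <= v ->
  (forall i, `|(A^T *m e) i 0| <= varrho) -> nearly_sparse s v x ->
  Argmin [set w | lnorm +oo%E (A^T *m (A *m w - (A *m x + e))) <= rho]
    (lnorm 1%E) xh ->
  lnorm p (xh - x) <= 2 * (3 * s)%:R `^ (fine p^-1%E) / (1 - 2 * kappa)
     * (2 * s%:R * lambda ^+ 2 * (rho + varrho) / (1 - 2 * kappa) + s%:R^-1 * v).
Proof.
move=> vr0 vr p1 pq v0 evr xv [xh_feas xh_min].
have k0 : 0 < 1 - 2 * kappa by move: kappa_lt; lra.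
have rho0 : 0 <= rho by rewrite ltW// (lt_le_trans vr0).
have l1_le : lnorm 1%E xh <= lnorm 1%E x.
  apply: xh_min; apply: lnorm_infty_le => // i.
  by rewrite opprD addrA subrr add0r mulmxN mxE normrN (le_trans (evr i)).
pose z := xh - x.
have corr j : `|(A^T *m (A *m z)) j 0| <= rho + varrho.
  have -> : A *m z = (A *m xh - (A *m x + e)) + e.
    by rewrite opprD addrA subrK mulmxBr.
  rewrite mulmxDr mxE; apply: le_trans (ler_normD _ _) _.
  by apply: lerD => //; apply: le_trans (le_lnorm_infty _ _) xh_feas.
have uN : lnorm 2%:E (A *m z) ^+ 2 <= (rho + varrho) * lnorm 1%E z.
  apply: le_trans (dot_mulmx_le z corr); apply: le_trans (ler_norm _).
  by rewrite lnorm2_sqr; apply: ler_sum => i _; rewrite expr2.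
have kN : (1 - 2 * kappa) * lnorm 1%E z <=
    2 * lambda * s%:R * lnorm 2%:E (A *m z) + 2 * v.
  move: l1_le (l1_error_bound xh xv); rewrite -/z.
  by move: (lnorm 1%E xh) (lnorm 1%E x) (lnorm 1%E z) (lnorm 2%:E _) => a b N u; lra.
have r0 : 0 < rho + varrho by rewrite addr_gt0// (lt_le_trans vr0).
have [N2 W2] := dantzig_estimate sR lambda_gt0 kappa_gt0 k0 r0 v0
  (lnorm1_ge0 z) (powR_ge0 _ _) kN uN erefl.
set W := (X in lnorm 1%E z <= 2 * s%:R * X) in N2 W2.
have V0 : 0 <= s%:R^-1 * v by rewrite mulr_ge0// invr_ge0 ltW.
have B0 : 0 < 2 * s%:R * lambda ^+ 2 * (rho + varrho) / (1 - 2 * kappa).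
  by rewrite !mulr_gt0 ?invr_gt0 ?exprn_gt0.
have W0 : 0 < W by rewrite divr_gt0// ltr_wpDr ?mulr_ge0.
have zW : trunc_norm s q z <= s%:R `^ (fine q^-1%E) * W.
  by apply: le_trans (trunc_norm_le z) _; rewrite ler_wpM2l ?powR_ge0.
apply: (le_trans (lnorm_le_of_trunc_norm s_gt0 s_le W0 p1 pq zW N2)).
rewrite (mulrC 2 (_ `^ _)) -!(mulrA (_ `^ _)) ler_wpM2l ?powR_ge0//.
rewrite /W [leRHS]mulrAC ler_wpM2r ?invr_ge0 ?(ltW k0)//.
by rewrite [leRHS]mulrDr lerD2r ler_peMl ?(ltW B0)// ler1n.
Qed.

(** Here g and h stand for the squared residuals of the estimate and of the true
    signal, D for the inner product of A z with the noise. *)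
Lemma lasso_basic_inequality (varkappa varrho v S a b N u D c g h : R) :
  0 < varkappa -> g = u ^+ 2 - 2 * D + c -> h = c ->
  a + varkappa * g <= b + varkappa * h -> D <= varrho * N ->
  (1 - 2 * kappa) * N <= 2 * lambda * S * u + 2 * v + (a - b) ->
  (1 - 2 * kappa - 2 * varrho * varkappa) * N + varkappa * u ^+ 2 <=
  2 * lambda * S * u + 2 * v.
Proof.
move=> vk0 -> -> H1 /(ler_wpM2l (ltW vk0)) H2 H3; lra.
Qed.

(** Expanding the squared residual of xh around the noise leaves, after comparison
    with the true signal, the square of the Euclidean norm of A z and a cross
    term of size at most varrho N.  The factor 4 absorbs
    (3 s)^(1/p) <= 3 s^(1/p). *)
Lemma lasso_error (varkappa varrho v : R) (p : \bar R) x xh e :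
  0 < varkappa -> 0 < varrho -> 2 * kappa + 2 * varrho * varkappa < 1 ->
  (1 <= p)%E -> (p <= q)%E -> 0 <= v ->
  (forall i, `|(A^T *m e) i 0| <= varrho) -> nearly_sparse s v x ->
  Argmin setT (fun w => lnorm 1%E w
      + varkappa * lnorm 2%:E (A *m w - (A *m x + e)) ^+ 2) xh ->
  lnorm p (xh - x) <=
    4 * s%:R `^ (fine p^-1%E) / (1 - 2 * kappa - 2 * varrho * varkappa)
     * (2 * s%:R * lambda ^+ 2 / varkappa + s%:R^-1 * v).
Proof.
move=> vk0 vr0 kk p1 pq v0 evr xv [_ xh_min].
have k0 : 0 < 1 - 2 * kappa - 2 * varrho * varkappa by lra.
move: xh_min => /(_ x I) xh_min.
pose z := xh - x.
have res : lnorm 2%:E (A *m xh - (A *m x + e)) ^+ 2 =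
    lnorm 2%:E (A *m z) ^+ 2 - 2 * \sum_i (A *m z) i 0 * e i 0
    + lnorm 2%:E e ^+ 2.
  have -> : A *m xh - (A *m x + e) = A *m z - e by rewrite opprD addrA mulmxBr.
  exact: lnorm2_sqrB.
have res0 : lnorm 2%:E (A *m x - (A *m x + e)) ^+ 2 = lnorm 2%:E e ^+ 2.
  have -> : A *m x - (A *m x + e) = - e by rewrite opprD addrA subrr add0r.
  exact: lnorm2_sqrN.
have dot : \sum_i (A *m z) i 0 * e i 0 <= varrho * lnorm 1%E z.
  by apply: le_trans (ler_norm _) _; exact: dot_mulmx_le.
have kN : (1 - 2 * kappa - 2 * varrho * varkappa) * lnorm 1%E z
    + varkappa * lnorm 2%:E (A *m z) ^+ 2 <=
    2 * lambda * s%:R * lnorm 2%:E (A *m z) + 2 * v.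
  exact: (lasso_basic_inequality vk0 res res0 xh_min dot (l1_error_bound xh xv)).
have [N2 W2] := lasso_estimate sR lambda_gt0 kappa_gt0 vk0 (ltW vr0) k0 v0
  (lnorm1_ge0 z) (powR_ge0 _ _) kN erefl.
set W := (X in lnorm 1%E z <= 2 * s%:R * X) in N2 W2.
have V0 : 0 <= s%:R^-1 * v by rewrite mulr_ge0// invr_ge0 ltW.
have B0 : 0 < 2 * s%:R * lambda ^+ 2 / varkappa.
  by rewrite !mulr_gt0 ?invr_gt0 ?exprn_gt0.
have W0 : 0 < W by exact: divr_gt0 (ltr_wpDr V0 B0) k0.
have zW : trunc_norm s q z <= s%:R `^ (fine q^-1%E) * W.
  by apply: le_trans (trunc_norm_le z) _; rewrite ler_wpM2l ?powR_ge0.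
apply: (le_trans (lnorm_le_of_trunc_norm s_gt0 s_le W0 p1 pq zW N2)).
apply: (@le_trans _ _ (4 * s%:R `^ (fine p^-1%E) * W)); last first.
  by rewrite /W [leRHS]mulrAC -[leRHS]mulrA.
exact: ler_wpM2r (ltW W0) _ _ (powR_inve_3mul_le s p1).
Qed.
End recovery.


(** * The risk bounds *)

Theorem proposition8 (R : realType) (d : measure_display) (T : measurableType d)
    (P : probability T R) (m n s : nat) (A : 'M[R]_(m, n)) (q : \bar R)
    (lambda kappa sigma eps : R) (xi : 'I_m -> {RV P >-> R})
    (hs : (0 < s)%N) (hsn : (s <= n)%N) (hq : (1 <= q)%E)
    (hlambda : 0 < lambda) (hkappa0 : 0 < kappa) (hkappa : kappa < 1 / 2)
    (hA : forall x : 'cV[R]_n,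
      trunc_norm s q x <=
        lambda * s%:R `^ (fine q^-1%E) * lnorm 2%:E (A *m x)
        + kappa * s%:R `^ (fine q^-1%E - 1) * lnorm 1%E x)
    (hsigma : 0 < sigma) (heps0 : 0 < eps) (heps1 : eps < 1)
    (hxi : standard_gaussian xi) :
  let beta := max_col_norm A in
  let varrho := sigma * beta * Num.sqrt (2 * ln (n%:R / eps)) in
  (forall (rho : R) (xDS : 'cV[R]_m -> 'cV[R]_n), varrho <= rho ->
     borel_fun xDS -> dantzig_selector A rho xDS ->
     forall (p : \bar R) (upsilon : R),
       (1 <= p)%E -> (p <= q)%E -> 0 <= upsilon ->
       (risk A xi xDS p eps sigma s upsilon <=
         (2 * (3 * s)%:R `^ (fine p^-1%E) / (1 - 2 * kappa)
          * (2 * s%:R * lambda ^+ 2 * (rho + varrho) / (1 - 2 * kappa)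
             + s%:R^-1 * upsilon))%:E)%E)
  /\
  (forall (varkappa : R) (xlasso : 'cV[R]_m -> 'cV[R]_n), 0 < varkappa ->
     2 * kappa + 2 * varrho * varkappa < 1 ->
     borel_fun xlasso -> lasso A varkappa xlasso ->
     forall (p : \bar R) (upsilon : R),
       (1 <= p)%E -> (p <= q)%E -> 0 <= upsilon ->
       (risk A xi xlasso p eps sigma s upsilon <=
         (4 * s%:R `^ (fine p^-1%E) / (1 - 2 * kappa - 2 * varrho * varkappa)
          * (2 * s%:R * lambda ^+ 2 / varkappa + s%:R^-1 * upsilon))%:E)%E)
  /\
  (forall xlasso : 'cV[R]_m -> 'cV[R]_n,
     borel_fun xlasso -> lasso A ((1 - 2 * kappa) / (4 * varrho)) xlasso ->
     forall (p : \bar R) (upsilon : R),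
       (1 <= p)%E -> (p <= q)%E -> 0 <= upsilon ->
       (risk A xi xlasso p eps sigma s upsilon <=
         (8 * s%:R `^ (fine p^-1%E) / (1 - 2 * kappa)
          * (8 * s%:R * varrho * lambda ^+ 2 / (1 - 2 * kappa)
             + s%:R^-1 * upsilon))%:E)%E).
Proof.
move=> beta varrho.
have n_gt0 : (0 < n)%N by exact: leq_trans hsn.
have sigma0 : 0 <= sigma by exact: ltW.
have beta0 : 0 < beta.
  exact: (max_col_norm_gt0 hs hsn hq hlambda hkappa0 hkappa hA).
have varrho0 : 0 < varrho.
  rewrite mulr_gt0 ?(mulr_gt0 hsigma)// sqrtr_gt0 mulr_gt0// ln_gt0//.
  by rewrite ltr_pdivlMr// mul1r (lt_le_trans heps1)// ler1n.
have risk_le xhat p v delta := @risk_le_bounded_correlation _ _ _ P m n s A xi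
  xhat p eps sigma v delta hxi n_gt0 heps0 heps1 sigma0.
have lasso_risk (varkappa : R) (xlasso : 'cV[R]_m -> 'cV[R]_n) : 0 < varkappa ->
    2 * kappa + 2 * varrho * varkappa < 1 -> lasso A varkappa xlasso ->
    forall (p : \bar R) (upsilon : R),
      (1 <= p)%E -> (p <= q)%E -> 0 <= upsilon ->
      (risk A xi xlasso p eps sigma s upsilon <=
        (4 * s%:R `^ (fine p^-1%E) / (1 - 2 * kappa - 2 * varrho * varkappa)
         * (2 * s%:R * lambda ^+ 2 / varkappa + s%:R^-1 * upsilon))%:E)%E.
  move=> vk0 vk1 xl p v p1 pq v0; apply: risk_le => e x ebd xs.
  exact: (lasso_error hs hsn hq hlambda hkappa0 hA vk0 varrho0 vk1 p1 pq v0 ebd xs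
    (xl (A *m x + e))).
split; last split.
- move=> rho xDS rho_ge _ xds p v p1 pq v0; apply: risk_le => e x ebd xs.
  exact: (dantzig_selector_error hs hsn hq hlambda hkappa0 hkappa hA varrho0
    rho_ge p1 pq v0 ebd xs (xds (A *m x + e))).
- by move=> varkappa xl vk0 vk1 _; exact: lasso_risk.
move=> xl _ xlP p v p1 pq v0.
have k0 : 0 < 1 - 2 * kappa by lra.
have vk0 : 0 < (1 - 2 * kappa) / (4 * varrho) by rewrite divr_gt0// mulr_gt0.
have half : 2 * varrho * ((1 - 2 * kappa) / (4 * varrho)) = (1 - 2 * kappa) / 2.
  by field; rewrite gt_eqF.
apply: le_trans (lasso_risk _ xl vk0 _ xlP p v p1 pq v0) _.
  by rewrite half; lra.
rewrite half lee_fin le_eqVlt; apply/orP; left; apply/eqP.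
have -> : 1 - 2 * kappa - (1 - 2 * kappa) / 2 = (1 - 2 * kappa) / 2 by lra.
move: k0; move: (1 - 2 * kappa) => k k0.
by field; rewrite ?gt_eqF// ltr0n.
Qed.
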